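(* Fix a constant $\beta\ge 0$. The class of distributions supported on $[0,1]$ with $\textsc{IrregCoeff}(F)\le\beta$ can be described with $\tilde{O}(\epsilon^{-1/2})$ bits and error $\epsilon$ (the hidden constants may depend on $\beta$).
   Context: For a distribution with CDF $F$, $\textsc{IrregCoeff}(F)=\inf\{\beta\ge0: q\mapsto qF^{-1}(1-q)+\beta\int_{1-q}^1F^{-1}(x)\,dx \text{ is concave on }[0,1]\}$. For smooth distributions (no point masses, $C^1$ PDF $f$), $\textsc{IrregCoeff}(F)\le\beta$ corresponds to $f'(v)(1-F(v))\ge-(2+\beta)f(v)^2$. The Lévy distance is $\mathrm{L\acute{e}vy}(F,G)=\inf\{\epsilon: F(v-\epsilon)-\epsilon\le G(v)\le F(v+\epsilon)+\epsilon\ \forall v\}$. A class $\mathcal{C}$ can be described with $b$ bits and error $\epsilon$ if there is a class $\mathcal{C}'$ with $|\mathcal{C}'|\le2^b$ such that every $F\in\mathcal{C}$ has some $F'\in\mathcal{C}'$ with $\mathrm{L\acute{e}vy}(F,F')\le\epsilon$. $\tilde{O}$ hides polylog$(1/\epsilon)$ factors. *)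

(* Defs.v *)
From HB Require Import structures.
From mathcomp Require Import all_boot all_order all_algebra.
From mathcomp Require Import all_classical all_reals all_analysis.
Set Implicit Arguments. Unset Strict Implicit. Unset Printing Implicit Defensive.
Import Order.TTheory GRing.Theory Num.Theory.
Import numFieldNormedType.Exports.
Local Open Scope classical_set_scope.
Local Open Scope ring_scope.

Section Defs.
Variable R : realType.

Definition is_cdf (F : R -> R) : Prop :=
  [/\ (forall x y, x <= y -> F x <= F y),
      (forall x, F @ x^'+ --> F x),
      F @ -oo --> (0 : R) &
      F @ +oo --> (1 : R)].

Definition supported01_cdf (F : R -> R) : Prop :=
  is_cdf F /\ (forall v, v < 0 -> F v = 0) /\ (forall v, 1 <= v -> F v = 1).

(* quantile F^{-1}(x) = inf {v : F v >= x}, with v restricted to [0,1]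
   (only changes the value at x = 0, to 0) *)
Definition quantile (F : R -> R) (x : R) : R :=
  inf [set v | 0 <= v <= 1 /\ x <= F v].

Definition concave_on01 (g : R -> R) : Prop :=
  forall x y t, 0 <= x <= 1 -> 0 <= y <= 1 -> 0 <= t <= 1 ->
    t * g x + (1 - t) * g y <= g (t * x + (1 - t) * y).

Definition irreg_fun (F : R -> R) (beta : R) (q : R) : R :=
  q * quantile F (1 - q) +
  beta * Rintegral (@lebesgue_measure R) `[1 - q, 1] (quantile F).

Definition IrregCoeff (F : R -> R) : \bar R :=
  ereal_inf [set b%:E | b in [set b : R | 0 <= b /\ concave_on01 (irreg_fun F b)]].

Definition Levy (F G : R -> R) : \bar R :=
  ereal_inf [set e%:E | e in [set e : R |
    forall v, F (v - e) - e <= G v /\ G v <= F (v + e) + e]].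

End Defs.

(* Main.v *)
Require Import Defs.
From HB Require Import structures.
From mathcomp Require Import all_boot all_order all_algebra.
From mathcomp Require Import all_classical all_reals all_analysis.
From mathcomp Require Import measurable_realfun lra ring zify.
Import Order.TTheory GRing.Theory Num.Theory.
Import numFieldNormedType.Exports.
Local Open Scope classical_set_scope.
Local Open Scope ring_scope.

(* Two members of the class that share a short code are close, so one
   representative per code value suffices.  Let u(q) = F^{-1}(1-q), let U be its
   primitive and put h(q) = q u(q) + B U(q) with B = beta + 1; h is concave.
   Sample at the points i/M, M = r^4, where r is of order eps^{-1/2}.  By
   concavity the slopes of h are monotone and, after normalisation, lie between
   1 and O(1/(1-q)); recording where their logarithm crosses the multiples of
   1/r determines every slope up to a relative error O(1/r).  Cut [0,1] into
   cells of length 1/r in the logit scale ln(q/(1-q)), so that a cell from k/M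
   to i/M has i/M - k/M = O(1/r) (k/M) (1 - i/M), and record u up to r^{-2} at
   the start of each cell.  Within a cell the factor 1-q of the length cancels
   the 1/(1-q) of the slope error, so h is known up to O(r^{-2}) q; the integral
   term is absorbed by induction along the cell, and u is known up to O(r^{-2})
   at every grid point beyond r^2/M.  Both records have O(r ln r) entries of
   O(ln r) bits. *)

(** * Quantiles and their integrals *)

Section Quantile.
Context {R : realType}.
Implicit Types (F : R -> R) (p v x y : R).

Lemma quantile_le F p v : 0 <= v <= 1 -> p <= F v -> quantile F p <= v.
Proof.
move=> v01 pF; apply: ge_inf => //.
by exists 0 => w [/andP[]].
Qed.

Lemma le_quantile F p v : p <= F 1 ->
  (forall w, 0 <= w <= 1 -> p <= F w -> v <= w) -> v <= quantile F p.
Proof.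
move=> pF1 lb; apply: lb_le_inf; first by exists 1; split => //; rewrite ler01 lexx.
by move=> w [w01 pFw]; exact: lb.
Qed.

Lemma quantile_ge0 F p : p <= F 1 -> 0 <= quantile F p.
Proof. by move=> pF1; apply: le_quantile => // w /andP[]. Qed.

Lemma quantile_le1 F p : p <= F 1 -> quantile F p <= 1.
Proof. by move=> pF1; apply: quantile_le => //; rewrite ler01 lexx. Qed.

Lemma quantile_homo F x y : y <= F 1 -> x <= y -> quantile F x <= quantile F y.
Proof.
move=> yF1 xy; apply: le_quantile => // w w01 yFw.
by apply: quantile_le => //; exact: le_trans xy yFw.
Qed.

(** Truncating at 1 keeps the integrand monotone on the whole line, hence measurable: for a CDF no
    [v] satisfies [x <= F v] once [x > 1], and the infimum of the empty set is 0. *)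
Lemma quantile_integrable F a b : F 1 = 1 ->
  (@lebesgue_measure R).-integrable `[a, b] (EFin \o (fun x => quantile F (Num.min x 1))).
Proof.
move=> F1.
have le1 x : Num.min x 1 <= F 1 by rewrite F1 ge_min lexx orbT.
apply: measurable_bounded_integrable => //.
- by rewrite /= lebesgue_measure_itv/=; case: ifP => _; rewrite ?ltry.
- apply: nondecreasing_measurable => // x y xy; apply: quantile_homo => //.
  by rewrite le_min !ge_min xy lexx orbT.
- exists 1; split; first exact: num_real.
  move=> M M1 x _ /=; rewrite ger0_norm ?quantile_ge0//.
  by apply: le_trans (ltW M1); exact: quantile_le1.
Qed.

(** The primitive U of u(q) = F^{-1}(1-q) that vanishes at 0. *)
Definition tail_int F (q : R) : R :=
  Rintegral (@lebesgue_measure R) `[1 - q, 1] (quantile F).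

Lemma Rintegral_cst_itv (a b r : R) : a <= b ->
  Rintegral (@lebesgue_measure R) `[a, b] (cst r) = (b - a) * r.
Proof.
move=> ab; rewrite Rintegral_cst//= lebesgue_measure_itv/= lte_fin mulrC.
case: ltgtP ab => [ab _|//|-> _]; last by rewrite subrr.
by rewrite -EFinD.
Qed.

(** Since u is nonincreasing, its integral is compared with the constants given by its two end
    values. These bounds replace differentiation of U, as u may jump. *)
Lemma tail_intB F x y : F 1 = 1 -> 0 <= x -> x <= y -> y <= 1 ->
  (y - x) * quantile F (1 - y) <= tail_int F y - tail_int F x
    <= (y - x) * quantile F (1 - x).
Proof.
move=> F1 x0 xy y1.
pose g z := quantile F (Num.min z 1).
have tE q : tail_int F q = Rintegral (@lebesgue_measure R) `[1 - q, 1] g.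
  apply: eq_Rintegral => z; rewrite inE/= in_itv/= => /andP[_ z1].
  by rewrite /g min_l.
have gi a b : (@lebesgue_measure R).-integrable `[a, b] (EFin \o g).
  exact: quantile_integrable.
have ci a b r : (@lebesgue_measure R).-integrable `[a, b] (EFin \o cst r).
  apply: measurable_bounded_integrable => //.
    by rewrite /= lebesgue_measure_itv/=; case: ifP => _; rewrite ?ltry.
  exists `|r|; split; first exact: num_real.
  by move=> M /ltW rM z _.
have tB : tail_int F y - tail_int F x = Rintegral (@lebesgue_measure R) `[1 - y, 1 - x] g.
  rewrite !tE.
  have -> : Rintegral (@lebesgue_measure R) `[1 - x, 1] g = Rintegral (@lebesgue_measure R) `]1 - x, 1] g.
    rewrite Rintegral_itv_obnd_cbnd//.
    by apply: integrableS (gi (1 - x) 1) => //; apply: subset_itv_oc_cc.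
  have := @Rintegral_itvB R g (BLeft (1 - y)) (BRight 1) (1 - x) (gi _ _).
  rewrite !bnd_simp => <- //; lra.
have yx : 1 - y <= 1 - x by lra.
have yxE : (1 - x) - (1 - y) = y - x by lra.
rewrite tB -yxE -!Rintegral_cst_itv//; apply/andP; split.
  apply: (le_Rintegral _ (ci _ _ _) (gi _ _)) => // z.
  rewrite /= in_itv/= => /andP[yz zx]; rewrite /g min_l; last lra.
  by apply: quantile_homo => //; lra.
apply: (le_Rintegral _ (gi _ _) (ci _ _ _)) => // z.
rewrite /= in_itv/= => /andP[yz zx]; rewrite /g min_l; last lra.
by apply: quantile_homo => //; lra.
Qed.

Lemma tail_int0 F : tail_int F 0 = 0.
Proof. by rewrite /tail_int subr0 set_itv1 Rintegral_set1. Qed.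

Lemma irreg_funE F b q : irreg_fun F b q = q * quantile F (1 - q) + b * tail_int F q.
Proof. by []. Qed.

End Quantile.

(** * Concavity and the Levy distance *)

Section Class.
Context {R : realType}.
Implicit Types (F G h : R -> R) (b x y : R).

Lemma supported01_1 F : supported01_cdf F -> F 1 = 1.
Proof. by move=> [_ [_ ->]]. Qed.

Lemma supported01_ge0 F v : supported01_cdf F -> 0 <= F v.
Proof.
move=> [[Fnd _ _ _] [F0 _]]; rewrite -(F0 (Num.min v (-1))).
  by apply: Fnd; rewrite ge_min lexx.
by rewrite gt_min ltrN10 orbT.
Qed.

Lemma supported01_le1 F v : supported01_cdf F -> F v <= 1.
Proof.
move=> [[Fnd _ _ _] [_ F1]]; rewrite -(F1 (Num.max v 1)).
  by apply: Fnd; rewrite le_max lexx.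
by rewrite le_max lexx orbT.
Qed.

(** The increments of U on both sides of the intermediate point [p] are compared with the same value
    u(p). Exchanging [t] and [1 - t] reduces to [x <= y]. *)
Lemma concave_tail_int F : F 1 = 1 -> concave_on01 (tail_int F).
Proof.
move=> F1; suff key x y t : 0 <= x <= 1 -> 0 <= y <= 1 -> 0 <= t <= 1 -> x <= y ->
    t * tail_int F x + (1 - t) * tail_int F y <= tail_int F (t * x + (1 - t) * y).
  move=> x y t x01 y01 t01; have [xy|/ltW yx] := leP x y; first exact: key.
  have t'01 : 0 <= 1 - t <= 1 by lra.
  have := key y x (1 - t) y01 x01 t'01 yx.
  have -> : 1 - (1 - t) = t by ring.
  have -> : (1 - t) * y + t * x = t * x + (1 - t) * y by ring.
  lra.
move=> /andP[x0 x1] /andP[y0 y1] /andP[t0 t1] xy.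
set p := t * x + (1 - t) * y.
have px : p - x = (1 - t) * (y - x) by rewrite /p; ring.
have yp : y - p = t * (y - x) by rewrite /p; ring.
have xp : x <= p by rewrite -subr_ge0 px mulr_ge0 ?subr_ge0.
have py : p <= y by rewrite -subr_ge0 yp mulr_ge0 ?subr_ge0.
have /andP[lb _] := @tail_intB R F x p F1 x0 xp (le_trans py y1).
have /andP[_ ub] := @tail_intB R F p y F1 (le_trans x0 xp) py y1.
rewrite px in lb; rewrite yp in ub.
have t1' : 0 <= 1 - t by rewrite subr_ge0.
move: (ler_wpM2l t0 lb) (ler_wpM2l t1' ub).
move: (tail_int F x) (tail_int F p) (tail_int F y) (quantile F (1 - p)) => a b c q.
clear; lra.
Qed.

Lemma concave_irreg_fun_le F b b' : F 1 = 1 -> b <= b' ->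
  concave_on01 (irreg_fun F b) -> concave_on01 (irreg_fun F b').
Proof.
move=> F1 bb' cb x y t x01 y01 t01.
have e q : irreg_fun F b' q = irreg_fun F b q + (b' - b) * tail_int F q.
  by rewrite !irreg_funE; ring.
have := cb _ _ _ x01 y01 t01; have := concave_tail_int F F1 _ _ _ x01 y01 t01.
rewrite !e -(subr_ge0 b) in bb' *; move=> /(ler_wpM2l bb').
move: (irreg_fun F b) (tail_int F) => f g; clear; lra.
Qed.

(** The infimum is not shown to be attained, hence the strict [b < b']: some admissible coefficient
    lies below [b'], and admissibility passes to larger coefficients. *)
Lemma IrregCoeff_concave F b b' : F 1 = 1 -> (IrregCoeff F <= b%:E)%E -> b < b' ->
  concave_on01 (irreg_fun F b').
Proof.
move=> F1 Fb bb'.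
have : (IrregCoeff F < b'%:E)%E by apply: le_lt_trans Fb _; rewrite lte_fin.
move=> /ereal_inf_lt[_ [c [c0 cc] <-]]; rewrite lte_fin => cb'.
exact: concave_irreg_fun_le (ltW cb') cc.
Qed.

(** Slopes decrease; the cross-multiplied form allows [z = y]. *)
Lemma concave_slopes h x y z : concave_on01 h -> 0 <= x -> x < y -> y <= z -> z <= 1 ->
  (h z - h y) * (y - x) <= (h y - h x) * (z - y).
Proof.
move=> ch x0 xy yz z1.
have xz : 0 < z - x by lra.
pose t := (z - y) / (z - x).
have tE : t * (z - x) = z - y by rewrite /t divfK ?gt_eqF.
have t0 : 0 <= t by rewrite divr_ge0 //; lra.
have t1 : t <= 1 by rewrite /t ler_pdivrMr// mul1r; lra.
have x01 : 0 <= x <= 1 by lra.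
have z01 : 0 <= z <= 1 by lra.
have t01 : 0 <= t <= 1 by rewrite t0.
have := ch _ _ _ x01 z01 t01.
have -> : t * x + (1 - t) * z = y by move: tE; clear; lra.
move=> /(ler_wpM2r (ltW xz)).
have -> : (t * h x + (1 - t) * h z) * (z - x) =
  t * (z - x) * h x + ((z - x) - t * (z - x)) * h z by ring.
rewrite tE; move: (h x) (h y) (h z) => a b c; clear; lra.
Qed.

(** If the inequality failed at [v], the first grid level [j/M] above [G v] would still be at most
    [F (v - eps)]. The quantile of F there is then at most [v - eps] and that of G at least [v],
    against closeness at [i = M - j]. The gap [eps >= (n+1)/M] ensures [i >= n], so the first [n]
    grid points are free. *)
Lemma grid_cdf_le F G (n M : nat) (eps : R) :
  supported01_cdf F -> supported01_cdf G -> (0 < M)%N ->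
  n.+1%:R / M%:R <= eps ->
  (forall i, (n <= i < M)%N ->
     quantile G (1 - i%:R / M%:R) - quantile F (1 - i%:R / M%:R) < eps) ->
  forall v, F (v - eps) - eps <= G v.
Proof.
move=> cF cG M0 nM close v; rewrite leNgt; apply/negP => lt.
have M0' : 0 < M%:R :> R by rewrite ltr0n.
have eps0 : 0 < eps by apply: lt_le_trans nM; rewrite divr_gt0.
have G0 : 0 <= G v by exact: supported01_ge0.
have F1 := supported01_1 _ cF; have G1 := supported01_1 _ cG.
have ve0 : 0 <= v - eps.
  rewrite leNgt; apply/negP => vlt; case: (cF) => _ [/(_ _ vlt) F0 _]; lra.
have v1 : v < 1.
  rewrite ltNge; apply/negP => vge; case: (cG) => _ [_ /(_ _ vge) Gv].
  by have := supported01_le1 _ (v - eps) cF; lra.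
have Fle1 : F (v - eps) <= 1 by exact: supported01_le1.
pose j := (Num.truncn (G v * M%:R)).+1.
have /andP[jle jgt] := @truncn_itv R (G v * M%:R) (mulr_ge0 G0 (ltW M0')).
have jM1 : j%:R <= (G v * M%:R) + 1 :> R by rewrite /j -natr1; lra.
have nM' : n.+1%:R <= eps * M%:R by rewrite -ler_pdivrMr.
have jnM : j%:R + n%:R < M%:R :> R.
  have : (eps + G v) * M%:R < 1 * M%:R by rewrite ltr_pM2r//; lra.
  by rewrite -natr1 in nM'; lra.
have jnM' : (j + n < M)%N by rewrite -(ltr_nat R) natrD.
have jF : j%:R / M%:R <= F (v - eps).
  rewrite ler_pdivrMr//; have : (eps + G v) * M%:R < F (v - eps) * M%:R by rewrite ltr_pM2r//; lra.
  have : (1 : R) <= n.+1%:R by rewrite ler1n.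
  lra.
have jG : G v < j%:R / M%:R by rewrite ltr_pdivlMr.
have j1 : (0 < j)%N by [].
have iM : (n <= M - j < M)%N by move: (j) j1 jnM'; clear; lia.
have := close _ iM.
have -> : 1 - (M - j)%:R / M%:R = j%:R / M%:R :> R.
  rewrite natrB; last by move: (j) jnM'; clear; lia.
  by rewrite mulrBl divff ?gt_eqF//; ring.
have ve01 : 0 <= v - eps <= 1 by lra.
have := quantile_le _ _ _ ve01 jF.
have : v <= quantile G (j%:R / M%:R).
  apply: le_quantile.
    by rewrite G1 ler_pdivrMr// mul1r ler_nat; move: (j) jnM'; clear; lia.
  move=> w _ jw; rewrite leNgt; apply/negP => /ltW wv.
  by case: cG => [[Gnd _ _ _] _]; have := Gnd _ _ wv; lra.
lra.
Qed.

Lemma grid_Levy_le F G (n M : nat) (eps : R) :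
  supported01_cdf F -> supported01_cdf G -> (0 < M)%N ->
  n.+1%:R / M%:R <= eps ->
  (forall i, (n <= i < M)%N ->
     `|quantile F (1 - i%:R / M%:R) - quantile G (1 - i%:R / M%:R)| < eps) ->
  (Levy F G <= eps%:E)%E.
Proof.
move=> cF cG M0 nM close; apply: ereal_inf_lbound; exists eps => // v.
split; first apply: (grid_cdf_le F G n M) => // i /close.
  by rewrite ltr_norml; lra.
(* The other inequality is the first one with F and G exchanged, taken at [v + eps]. *)
rewrite -lerBlDr -{1}(addrK eps v).
apply: (grid_cdf_le G F n M) => // i /close.
by rewrite ltr_norml; lra.
Qed.

End Class.

(** * Stability on a cell *)

Section Cell.
Context {R : realFieldType}.

(** Equals M h(j/M) when [v] samples u at j/M and [I] samples M U. *)
Definition discrete_irreg (B : R) (v I : nat -> R) (j : nat) := j%:R * v j + B * I j.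

(** Induction along the cell: the integral terms at one index involve closeness only at earlier
    indices. The last hypothesis says that the bound [E] reproduces itself. *)
Lemma cell_estimate (B c c' d theta kappa E : R) (k m : nat) (u w J K : nat -> R)
  (h := discrete_irreg B) :
  0 <= B -> 0 <= c -> (0 < k)%N -> (k <= m)%N ->
  (forall j, (k <= j <= m)%N -> 0 <= u j <= 1) ->
  (forall j, (k <= j <= m)%N -> 0 <= w j <= 1) ->
  (forall j, (k <= j < m)%N -> u j.+1 <= J j.+1 - J j <= u j) ->
  (forall j, (k <= j < m)%N -> w j.+1 <= K j.+1 - K j <= w j) ->
  (forall j, (k <= j < m)%N ->
    `|(h u J j.+1 - h u J j) - (h w K j.+1 - h w K j)| <= c) ->
  `|u k - w k| <= d ->
  c * (m - k)%:R <= c' * k%:R ->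
  (m - k)%:R <= theta * k%:R ->
  1 <= kappa * k%:R ->
  0 <= E -> d + c' + B * (theta * E + 2 * kappa) <= E ->
  `|u m - w m| <= E.
Proof.
move=> B0 c0 k0 km u01 w01 JB KB slopes start len_c len_theta kappa_k E0 close.
have kkm : (k <= k <= m)%N by rewrite leqnn.
have /andP[uk0 uk1] := u01 _ kkm; have /andP[wk0 wk1] := w01 _ kkm.
pose dh n := (h u J (k + n)%N - h u J k) - (h w K (k + n)%N - h w K k).
pose dJ n := (J (k + n)%N - J k) - (K (k + n)%N - K k).
(* The increments of [J] and [K] match [u j] and [w j] only up to the drop in one step. These drops
   telescope to [vard], which is at most 2 and yields the term [2 * kappa]. *)
pose vard n := (u k - u (k + n)%N) + (w k - w (k + n)%N).
have pointwise n : (k + n <= m)%N -> `|dh n| <= n%:R * c ->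
    `|dJ n| <= n%:R * E + vard n -> `|u (k + n)%N - w (k + n)%N| <= E.
  move=> knm H1 H2.
  have knm' : (k <= k + n <= m)%N by rewrite leq_addr.
  have /andP[u0 _] := u01 _ knm'; have /andP[w0 _] := w01 _ knm'.
  have nm : n%:R <= (m - k)%:R :> R by rewrite ler_nat leq_subRL.
  have k0' : 0 < k%:R :> R by rewrite ltr0n.
  have i_k : k%:R <= (k + n)%:R :> R by rewrite ler_nat leq_addr.
  have i0' : 0 < (k + n)%:R :> R := lt_le_trans k0' i_k.
  have H1' : `|dh n| <= c' * k%:R.
    apply: le_trans len_c; apply: le_trans H1 _.
    by rewrite mulrC ler_wpM2l.
  have H2' : `|dJ n| <= (theta * E + 2 * kappa) * k%:R.
    have : n%:R * E <= (theta * k%:R) * E by rewrite ler_wpM2r//; apply: le_trans nm _.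
    move: (dJ n) H2 u0 w0 uk1 wk1 kappa_k; rewrite /vard; clear => x; lra.
  rewrite -(ler_pM2l i0') -[X in X * _ <= _]gtr0_norm// -normrM.
  (* Solve the definition of h for [j * u j], at both ends and for both sequences. *)
  have -> : (k + n)%:R * (u (k + n)%N - w (k + n)%N) =
      k%:R * (u k - w k) + dh n - B * dJ n.
    by rewrite /dh /dJ /h /discrete_irreg; ring.
  apply: le_trans (ler_normB _ _) _.
  apply: le_trans (lerD (ler_normD _ _) (lexx _)) _.
  rewrite !normrM (ger0_norm B0) (gtr0_norm k0').
  move: (ler_wpM2l (ltW k0') start) (ler_wpM2l B0 H2') (ler_wpM2r (ltW k0') close).
  move: (ler_wpM2r E0 i_k) H1'; move: (dh n) (dJ n); clear => x y; lra.
have invariant n : (k + n <= m)%N -> [/\ `|dh n| <= n%:R * c,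
    `|dJ n| <= n%:R * E + vard n & `|u (k + n)%N - w (k + n)%N| <= E].
  elim: n => [|n IH] knm.
    have [H1 H2] : `|dh 0%N| <= 0%:R * c /\ `|dJ 0%N| <= 0%:R * E + vard 0%N.
      by rewrite /dh /dJ /vard addn0 !subrr !mul0r !normr0 !addr0.
    by split => //; exact: pointwise.
  have kj : (k <= k + n < m)%N by rewrite leq_addr -addnS.
  have [H1 H2 H3] := IH (ltnW (proj2 (andP kj))).
  have [G1 G2] : `|dh n.+1| <= n.+1%:R * c /\ `|dJ n.+1| <= n.+1%:R * E + vard n.+1.
    move: H1 H2 H3 (slopes _ kj) (JB _ kj) (KB _ kj); rewrite /dh /dJ /vard.
    rewrite addnS -(addn1 n) natrD.
    move: (h u J) (h w K) => f g H1 H2 H3 H4 H5 H6.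
    split; first by move: H1 H4; rewrite !ler_norml; clear; lra.
    by move: H2 H3 H5 H6; rewrite !ler_norml; clear; lra.
  by split => //; exact: pointwise.
by have := invariant (m - k)%N; rewrite subnKC// leqnn => /(_ isT)[].
Qed.

End Cell.

(** * Monotone sequences and their level crossings *)

Lemma nondecreasing_find (M : nat) (c : nat -> nat) (i m : nat) :
  (forall i j, (i <= j < M)%N -> (c i <= c j)%N) -> (i < M)%N ->
  (find (fun j => m <= c j)%N (iota 0 M) <= i)%N = (m <= c i)%N.
Proof.
move=> nd iM; set a := fun j => _; apply/idP/idP => [fi|mi].
  have has_a : has a (iota 0 M).
    by rewrite has_find size_iota; apply: leq_ltn_trans iM.
  have := nth_find 0 has_a; rewrite nth_iota ?add0n; last first.
    by rewrite -[X in (_ < X)%N](size_iota 0) -has_find.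
  by move=> /leq_trans; apply; apply: nd; rewrite fi.
rewrite leqNgt; apply/negP => /(before_find 0).
by rewrite nth_iota// add0n /a mi.
Qed.

(** A monotone sequence of [M] values below [N] is recovered from [N] crossing indices, which is
    what keeps the code short. A level never reached gives the index [M]. *)
Lemma find_eq_nondecreasing (M N : nat) (c c' : nat -> nat) :
  (forall i j, (i <= j < M)%N -> (c i <= c j)%N) ->
  (forall i j, (i <= j < M)%N -> (c' i <= c' j)%N) ->
  (forall i, (i < M)%N -> (c i < N)%N) ->
  (forall i, (i < M)%N -> (c' i < N)%N) ->
  (forall m, (m < N)%N -> find (fun j => m <= c j)%N (iota 0 M) =
                          find (fun j => m <= c' j)%N (iota 0 M)) ->
  forall i, (i < M)%N -> c i = c' i.
Proof.
move=> nd nd' cN c'N eqf i iM.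
have key m : (m < N)%N -> (m <= c i)%N = (m <= c' i)%N.
  by move=> mN; rewrite -(nondecreasing_find M c)// eqf// nondecreasing_find.
by apply/eqP; rewrite eqn_leq -key ?cN// leqnn key ?c'N// leqnn.
Qed.

(** * Slopes of the irregularity function *)

Section Slopes.
Context {R : realType}.
Implicit Types (F G : R -> R) (B : R).

Lemma irreg_fun_itv F B q : F 1 = 1 -> 0 <= B -> 0 <= q <= 1 ->
  0 <= irreg_fun F B q <= (1 + B) * q.
Proof.
move=> F1 B0 /andP[q0 q1].
have /andP[lb ub] := @tail_intB R F 0 q F1 (lexx _) q0 q1.
rewrite subr0 tail_int0 !subr0 in lb ub.
have qF1 : 1 - q <= F 1 by rewrite F1 lerBlDr lerDl.
have u0 := quantile_ge0 _ _ qF1; have u1 := quantile_le1 _ _ qF1.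
have v1 : quantile F 1 <= 1 by apply: quantile_le1; rewrite F1.
have T1 : tail_int F q <= q by apply: le_trans ub _; rewrite ler_piMr.
have T0 : 0 <= tail_int F q by apply: le_trans lb; rewrite mulr_ge0.
rewrite irreg_funE addr_ge0 ?mulr_ge0//= mulrDl mul1r lerD ?ler_piMr//.
by rewrite ler_wpM2l.
Qed.

(* Normalised so that [slope_defect] is nondecreasing in [j] and at least [1],
   which makes its logarithm a meaningful scale *)
Definition slope_defect F B (M j : nat) : R :=
  2 + B - M%:R * (irreg_fun F B (j.+1%:R / M%:R) - irreg_fun F B (j%:R / M%:R)).

Lemma grid01 (M j : nat) : (j <= M)%N -> 0 <= (j%:R / M%:R : R) <= 1.
Proof.
case: M => [|m] jM; first by rewrite invr0 mulr0 lexx ler01.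
by rewrite divr_ge0//= ler_pdivrMr ?ltr0n// mul1r ler_nat.
Qed.

Lemma gridS (M j : nat) : j.+1%:R / M%:R = j%:R / M%:R + M%:R^-1 :> R.
Proof. by rewrite -natr1 mulrDl mul1r. Qed.

(** By concavity a slope is at most that of the chord from 0 to the left end of the step, and h(q)
    <= (1 + B) q with h(0) = 0. The first step uses this bound directly. *)
Lemma slope_defect_ge1 F B (M j : nat) : F 1 = 1 -> 0 <= B ->
  concave_on01 (irreg_fun F B) -> (j < M)%N -> 1 <= slope_defect F B M j.
Proof.
move=> F1 B0 ch jM; have M0 : 0 < M%:R :> R by rewrite ltr0n; apply: leq_ltn_trans jM.
have /andP[x0 x1] := grid01 M j (ltnW jM); have /andP[y0 y1] := grid01 M _ jM.
have /andP[h0 h1] := irreg_fun_itv F B _ F1 B0 (grid01 M _ jM).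
have /andP[g0 g1] := irreg_fun_itv F B _ F1 B0 (grid01 M _ (ltnW jM)).
suff : M%:R * (irreg_fun F B (j.+1%:R / M%:R) - irreg_fun F B (j%:R / M%:R)) <= 1 + B.
  by rewrite /slope_defect; move: (M%:R * _) => a; clear; lra.
rewrite mulrC -ler_pdivlMr//.
have [j0|j0] := posnP j.
  move: h1 g0; rewrite j0 mul0r div1r; clear; lra.
have xgt0 : 0 < j%:R / M%:R :> R by rewrite divr_gt0// ltr0n.
have xy : j%:R / M%:R <= j.+1%:R / M%:R :> R by rewrite gridS lerDl invr_ge0 ltW.
have := concave_slopes _ _ _ _ ch (lexx 0) xgt0 xy y1.
have : irreg_fun F B 0 = 0 by rewrite irreg_funE mul0r tail_int0 mulr0 addr0.
move=> ->; rewrite !subr0 gridS (addrC (j%:R / M%:R)) addrK => s.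
rewrite -(ler_pM2r xgt0); apply: le_trans s _.
rewrite mulrAC ler_wpM2r// invr_ge0 ltW//.
Qed.

(** The slope of a step starting at x is at least that of the chord from x to 1, hence at least -(1
    + B)/(1 - x). Products instead of quotients cover the last step, which ends at 1. *)
Lemma slope_defect_le F B (M j : nat) : F 1 = 1 -> 0 <= B ->
  concave_on01 (irreg_fun F B) -> (j < M)%N ->
  slope_defect F B M j <= (3 + 2 * B) * (M%:R / (M - j)%:R).
Proof.
move=> F1 B0 ch jM; have M0 : 0 < M%:R :> R by rewrite ltr0n; apply: leq_ltn_trans jM.
have /andP[x0 x1] := grid01 M j (ltnW jM); have /andP[y0 y1] := grid01 M _ jM.
have /andP[h0 h1] := irreg_fun_itv F B 1 F1 B0 (introT andP (conj ler01 (lexx 1))).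
have /andP[g0 g1] := irreg_fun_itv F B _ F1 B0 (grid01 M _ (ltnW jM)).
have xy : j%:R / M%:R < j.+1%:R / M%:R :> R by rewrite gridS ltrDl invr_gt0.
have := concave_slopes _ _ _ _ ch x0 xy y1 (lexx 1).
have Mj0 : 0 < (M - j)%:R :> R by rewrite ltr0n subn_gt0.
rewrite mulrA ler_pdivlMr// /slope_defect.
move: (irreg_fun F B 1) (irreg_fun F B (j%:R / M%:R)) (irreg_fun F B (j.+1%:R / M%:R)) h0 g1 => h1' gx gy h0 g1.
rewrite gridS addrAC subrr add0r => s.
have : (h1' - gy) * M%:R^-1 * M%:R * M%:R <= (gy - gx) * (1 - (j%:R / M%:R + M%:R^-1)) * M%:R * M%:R.
  by rewrite !ler_pM2r.
rewrite mulfVK ?gt_eqF//.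
have -> : (gy - gx) * (1 - (j%:R / M%:R + M%:R^-1)) * M%:R * M%:R = M%:R * (gy - gx) * (M%:R - j%:R - 1).
  by field; rewrite gt_eqF.
have gxB : gx <= 1 + B by apply: le_trans g1 _; rewrite ler_piMr// addr_ge0.
have j0 : 0 <= j%:R :> R by [].
rewrite natrB; last exact: ltnW.
have Bj := ler_wpM2l B0 j0.
move: Bj (ler_wpM2r (ltW M0) gxB) (ler_wpM2r (ltW M0) h0) j0; clear; lra.
Qed.

Lemma slope_defect_homo F B (M i j : nat) : concave_on01 (irreg_fun F B) ->
  (i <= j < M)%N ->
  slope_defect F B M i <= slope_defect F B M j.
Proof.
move=> ch; elim: j => [|j IH] /andP[ij jM]; first by move: ij; rewrite leqn0 => /eqP->.
move: ij; rewrite leq_eqVlt => /predU1P[->//|ij].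
apply: le_trans (IH _) _; first by rewrite -ltnS ij ltnW.
have M0 : 0 < M%:R :> R by rewrite ltr0n; apply: leq_ltn_trans jM.
have /andP[x0 _] := grid01 M j (ltnW (ltnW jM)); have /andP[_ z1] := grid01 M _ jM.
have xy k : k%:R / M%:R < k.+1%:R / M%:R :> R by rewrite gridS ltrDl invr_gt0.
have := concave_slopes _ _ _ _ ch x0 (xy j) (ltW (xy j.+1)) z1.
have d k : k.+1%:R / M%:R - k%:R / M%:R = M%:R^-1 :> R by rewrite gridS addrAC subrr add0r.
rewrite !d ler_pM2r ?invr_gt0// => s.
by rewrite /slope_defect lerB// ler_pM2l.
Qed.

Lemma truncn_eq_ltr (a b : R) : 0 <= a -> 0 <= b -> Num.truncn a = Num.truncn b ->
  b - a < 1.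
Proof.
move=> a0 b0 ab; have /andP[a1 a2] := truncn_itv a0; have /andP[b1 b2] := truncn_itv b0.
move: a1 b2; rewrite ab -natr1; clear; lra.
Qed.

(* If [ln b - ln a < t <= 1/2] then [b < a e^t <= a (1 + 2 t)] *)
Lemma truncn_ln_eq_le (r : nat) (a b : R) : (1 < r)%N -> 1 <= a -> 1 <= b ->
  Num.truncn (r%:R * ln a) = Num.truncn (r%:R * ln b) -> b - a <= 2 / r%:R * a.
Proof.
move=> r1 a1 b1 ab.
have a0 : 0 < a := lt_le_trans ltr01 a1; have b0 : 0 < b := lt_le_trans ltr01 b1.
have r2 : 2 <= r%:R :> R by rewrite ler_nat.
have r0 : 0 < r%:R :> R by apply: lt_le_trans r2.
have lna : 0 <= r%:R * ln a by rewrite mulr_ge0 ?ln_ge0.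
have lnb : 0 <= r%:R * ln b by rewrite mulr_ge0 ?ln_ge0.
have lt1 := truncn_eq_ltr _ _ lna lnb ab.
set t := r%:R^-1.
have t0 : 0 < t by rewrite invr_gt0.
have t12 : t <= 1 / 2 by rewrite ler_pdivlMr// mulrC ler_pdivrMr// mul1r.
have ln_lt : ln b < ln a + t.
  by rewrite -ltrBlDl -(ltr_pM2l r0) mulrBr divff ?gt_eqF.
have : b <= a * expR t.
  rewrite -(lnK b0) -[X in X * _](lnK a0) -expRD ler_expR.
  by rewrite ltW.
(* From [1 - t <= exp (-t)] one gets [exp t <= 1 / (1 - t)], which is at most [1 + 2 t] for
   [t <= 1/2]. *)
have := expR_ge1Dx (- t); rewrite expRN => eN.
have et0 := expR_gt0 t.
have {}eN : (1 - t) * expR t <= 1 by rewrite -ler_pdivlMr// div1r.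
have et : expR t <= 1 + 2 * t.
  have tt : 0 <= (1 - 2 * t) * t by apply: mulr_ge0 (ltW t0); move: t12; clear; lra.
  have t1 : 0 < 1 - t by move: t12; clear; lra.
  rewrite -(ler_pM2l t1); move: (expR t) eN tt; clear => e; lra.
move=> /le_trans/(_ (ler_wpM2l (ltW a0) et)); clear; lra.
Qed.

End Slopes.

(** * The code *)

Section Code.
Context {R : realType}.
Implicit Types (F G : R -> R) (B : R) (r N i j k m : nat).

Definition slope_level B r F j : nat :=
  Num.truncn (r%:R * ln (slope_defect F B (r ^ 4) j)).

(** The odds q/(1-q) at q = j/M, scaled by M so that the logarithm is nonnegative from [j = 1]
    on. *)
Definition grid_odds r j : R := (r ^ 4)%:R * (j%:R / (r ^ 4 - j)%:R).

Definition odds_cell r j : nat := Num.truncn (r%:R * ln (grid_odds r j)).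

(* The least [j >= r ^ 2] lying in cell [m], and [0] when there is none *)
Definition cell_start r m : nat :=
  nth 0 (iota (r ^ 2) (r ^ 4 - r ^ 2))
    (find (fun j => odds_cell r j == m) (iota (r ^ 2) (r ^ 4 - r ^ 2))).

Definition grid_quantile r F j : R := quantile F (1 - j%:R / (r ^ 4)%:R).

(** Entry [m] holds the crossing index of slope level [m] and the rounded quantile at the start of
    cell [m]. Both fit below [(r ^ 4).+1], so [inord] loses nothing. *)
Definition cdf_code B r N F : {ffun 'I_N -> 'I_(r ^ 4).+1 * 'I_(r ^ 4).+1} :=
  [ffun m : 'I_N =>
    (inord (find (fun j => m <= slope_level B r F j)%N (iota 0 (r ^ 4))),
     inord (Num.truncn ((r ^ 2)%:R * grid_quantile r F (cell_start r m))))].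

(** The factor 8 serves both scales: odds are at most r^8, and slope defects at most r^5 once
    [3 + 2 * B <= r]. *)
Definition code_length r : nat := (Num.truncn (8 * (r%:R * ln r%:R) : R)).+1.

Lemma truncn_ln_lt_code_length r (x : R) n : (n <= 8)%N -> (1 < r)%N -> 1 <= x ->
  x <= r%:R ^+ n -> (Num.truncn (r%:R * ln x) < code_length r)%N.
Proof.
move=> n8 r1 x1 xr; rewrite /code_length ltnS; apply: Num.Theory.le_truncn.
have r0 : 0 < r%:R :> R by rewrite ltr0n; apply: leq_trans r1.
have x0 : 0 < x := lt_le_trans ltr01 x1.
have lnr : 0 <= ln (r%:R : R) by rewrite ln_ge0// ler1n ltnW.
rewrite mulrCA ler_pM2l//.
have : ln x <= ln (r%:R ^+ n) by rewrite ler_ln// posrE exprn_gt0.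
rewrite lnXn// -[_ *+ n]mulr_natl => /le_trans; apply.
by rewrite ler_wpM2r// ler_nat.
Qed.

Lemma grid_odds_ge1 r j : (0 < j < r ^ 4)%N -> 1 <= grid_odds r j.
Proof.
move=> /andP[j0 jM]; have Mj0 : 0 < (r ^ 4 - j)%:R :> R by rewrite ltr0n subn_gt0.
rewrite /grid_odds mulrA ler_pdivlMr// mul1r -natrM ler_nat.
by apply: leq_trans (leq_subr _ _) _; rewrite leq_pmulr.
Qed.

Lemma grid_odds_le r j : (j < r ^ 4)%N -> grid_odds r j <= r%:R ^+ 8.
Proof.
move=> jM; have Mj0 : 0 < (r ^ 4 - j)%:R :> R by rewrite ltr0n subn_gt0.
rewrite /grid_odds mulrA ler_pdivrMr// -natrM -natrX -natrM ler_nat.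
rewrite (_ : 8 = 4 + 4)%N// expnD -mulnA leq_pmul2l; last exact: leq_ltn_trans jM.
by apply: leq_trans (ltnW jM) _; rewrite leq_pmulr// subn_gt0.
Qed.

(** Odds in one cell agree up to a factor 1 + 2/r; clearing denominators leaves the factor
    [r ^ 4 - i], which later cancels the growth of the slopes near 1. *)
Lemma odds_cell_dist r k i : (1 < r)%N -> (0 < k)%N -> (k <= i < r ^ 4)%N ->
  odds_cell r k = odds_cell r i ->
  (i - k)%:R * (r ^ 4)%:R <= 2 / r%:R * k%:R * (r ^ 4 - i)%:R :> R.
Proof.
move=> r1 k0 /andP[ki iM] ki_cell.
have kM : (k < r ^ 4)%N := leq_ltn_trans ki iM.
have Mk0 : 0 < (r ^ 4 - k)%:R :> R by rewrite ltr0n subn_gt0.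
have Mi0 : 0 < (r ^ 4 - i)%:R :> R by rewrite ltr0n subn_gt0.
have ok : 1 <= grid_odds r k by rewrite grid_odds_ge1// k0.
have oi : 1 <= grid_odds r i by rewrite grid_odds_ge1// iM (leq_trans k0).
have := truncn_ln_eq_le _ _ _ r1 ok oi ki_cell.
have M0 : 0 < (r ^ 4)%:R :> R by rewrite ltr0n; apply: leq_ltn_trans kM.
rewrite /grid_odds -mulrBr mulrCA ler_pM2l//.
move: Mk0 Mi0; rewrite !natrB ?(ltnW kM) ?(ltnW iM)//.
move: (r ^ 4)%:R => M Mk0 Mi0 /(ler_wpM2r (ltW (mulr_gt0 Mk0 Mi0))).
have -> : (i%:R / (M - i%:R) - k%:R / (M - k%:R)) * ((M - k%:R) * (M - i%:R)) =
    (i%:R - k%:R) * M by field; rewrite !gt_eqF.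
suff -> : 2 / r%:R * (k%:R / (M - k%:R)) * ((M - k%:R) * (M - i%:R)) =
    2 / r%:R * k%:R * (M - i%:R) by [].
by field; rewrite !gt_eqF// ltr0n (leq_trans _ r1).
Qed.

(** The index [i] itself witnesses that its cell is nonempty, so the default 0 does not arise. *)
Lemma cell_startP r i : (0 < r)%N -> (r ^ 2 <= i < r ^ 4)%N ->
  let k := cell_start r (odds_cell r i) in
  (r ^ 2 <= k <= i)%N /\ odds_cell r k = odds_cell r i.
Proof.
move=> r0 /andP[ri iM] k; rewrite /k /cell_start.
set s := iota _ _; set a := fun j => _.
have is_ : i \in s by rewrite mem_iota ri subnKC// (leq_trans ri (ltnW iM)).
have has_a : has a s by apply/hasP; exists i => //; exact: eqxx.
have fs : (find a s < size s)%N by rewrite -has_find.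
split; last by apply/eqP; exact: (nth_find 0%N has_a).
rewrite nth_iota; last by rewrite -(size_iota (r ^ 2) (r ^ 4 - r ^ 2)).
rewrite leq_addr/= -leq_subRL// leqNgt; apply/negP => /(before_find 0%N).
by rewrite nth_iota ?subnKC ?/a ?eqxx// ltn_sub2r// (leq_ltn_trans ri).
Qed.

Lemma grid_quantile_itv r F j : F 1 = 1 -> (j <= r ^ 4)%N ->
  0 <= grid_quantile r F j <= 1.
Proof.
move=> F1 jM; have /andP[x0 x1] := @grid01 R (r ^ 4) j jM.
have p1 : 1 - j%:R / (r ^ 4)%:R <= F 1 by rewrite F1 lerBlDr lerDl.
by rewrite quantile_ge0// quantile_le1.
Qed.

Lemma slope_level_lt B r F j : F 1 = 1 -> 0 <= B -> concave_on01 (irreg_fun F B) ->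
  (1 < r)%N -> 3 + 2 * B <= r%:R -> (j < r ^ 4)%N ->
  (slope_level B r F j < code_length r)%N.
Proof.
move=> F1 B0 ch r1 Br jM.
have z1 := slope_defect_ge1 _ _ _ _ F1 B0 ch jM.
apply: (@truncn_ln_lt_code_length _ _ 5) => //.
apply: le_trans (slope_defect_le _ _ _ _ F1 B0 ch jM) _.
have Mj0 : 1 <= (r ^ 4 - j)%:R :> R by rewrite ler1n subn_gt0.
have MM : (r ^ 4)%:R / (r ^ 4 - j)%:R <= (r ^ 4)%:R :> R.
  by rewrite ler_pdivrMr ?(lt_le_trans ltr01)// ler_peMr.
by rewrite exprS -natrX ler_pM// addr_ge0// mulr_ge0.
Qed.

Lemma slope_level_homo B r F i j : F 1 = 1 -> 0 <= B ->
  concave_on01 (irreg_fun F B) -> (i <= j < r ^ 4)%N ->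
  (slope_level B r F i <= slope_level B r F j)%N.
Proof.
move=> F1 B0 ch ij; have /andP[ij' jM] := ij.
have zi := slope_defect_ge1 _ _ _ _ F1 B0 ch (leq_ltn_trans ij' jM).
have zz := slope_defect_homo _ _ _ _ _ ch ij.
have zi0 := lt_le_trans ltr01 zi.
have zj0 := lt_le_trans zi0 zz.
apply: Num.Theory.le_truncn; apply: ler_wpM2l; first exact: ler0n.
by rewrite ler_ln.
Qed.

Lemma cell_start_le r m : (cell_start r m <= r ^ 4)%N.
Proof.
rewrite /cell_start; set s := iota _ _; set i := find _ _.
have [si|si] := leqP (size s) i; first by rewrite nth_default.
have := mem_nth 0%N si; rewrite mem_iota => /andP[_ /ltnW /leq_trans]; apply.
case: (leqP (r ^ 2) (r ^ 4)) => [|/ltnW] rr; first by rewrite subnKC.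
by move: si; rewrite size_iota (eqP rr).
Qed.

Lemma truncn_quantile_lt r F m : F 1 = 1 ->
  (Num.truncn ((r ^ 2)%:R * grid_quantile r F (cell_start r m)) < (r ^ 4).+1)%N.
Proof.
move=> F1; have /andP[_ u1] := grid_quantile_itv r _ _ F1 (cell_start_le r m).
rewrite ltnS truncn_le_nat -natr1.
apply: le_lt_trans (_ : (r ^ 2)%:R * 1 < _); first by rewrite ler_wpM2l.
rewrite mulr1 natr1 ltr_nat ltnS; case: r {m u1} => [//|r].
by rewrite leq_pexp2l.
Qed.

Lemma inord_inj_lt n i j : (i < n.+1)%N -> (j < n.+1)%N ->
  inord i = inord j :> 'I_n.+1 -> i = j.
Proof. by move=> ni nj /(congr1 (@nat_of_ord _)); rewrite !inordK. Qed.

Lemma code_eqP B r F G : F 1 = 1 -> G 1 = 1 ->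
  cdf_code B r (code_length r) F = cdf_code B r (code_length r) G ->
  forall m, (m < code_length r)%N ->
  find (fun j => m <= slope_level B r F j)%N (iota 0 (r ^ 4)) =
    find (fun j => m <= slope_level B r G j)%N (iota 0 (r ^ 4)) /\
  Num.truncn ((r ^ 2)%:R * grid_quantile r F (cell_start r m)) =
    Num.truncn ((r ^ 2)%:R * grid_quantile r G (cell_start r m)).
Proof.
move=> F1 G1 FG m mN; have /ffunP/(_ (Ordinal mN)) := FG.
have fM a : (find a (iota 0 (r ^ 4)) < (r ^ 4).+1)%N.
  by rewrite ltnS -[X in (_ <= X)%N](size_iota 0) find_size.
rewrite !ffunE => /pair_equal_spec[e1 e2]; split.
  exact: inord_inj_lt e1.
by apply: inord_inj_lt e2; exact: truncn_quantile_lt.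
Qed.

(** Equal codes give equal slope levels at every grid point and nearly equal quantiles at the start
    [k] of the cell of [i]; the cell estimate then runs from [k] to [i]. *)
Lemma code_quantile_close B r F G i : F 1 = 1 -> G 1 = 1 -> 0 <= B ->
  concave_on01 (irreg_fun F B) -> concave_on01 (irreg_fun G B) ->
  (1 < r)%N -> 3 + 4 * B <= r%:R ->
  cdf_code B r (code_length r) F = cdf_code B r (code_length r) G ->
  (r ^ 2 <= i < r ^ 4)%N ->
  `|grid_quantile r F i - grid_quantile r G i| <= (26 + 20 * B) / r%:R ^+ 2.
Proof.
move=> F1 G1 B0 cF cG r1 Br FG ri; have /andP[r2i iM] := ri.
have FGm := code_eqP _ _ _ _ F1 G1 FG.
have Br' : 3 + 2 * B <= r%:R by move: B0 Br; clear; lra.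
have levels j : (j < r ^ 4)%N -> slope_level B r F j = slope_level B r G j.
  apply: (@find_eq_nondecreasing _ (code_length r)).
  - by move=> a b; exact: slope_level_homo.
  - by move=> a b; exact: slope_level_homo.
  - by move=> a aM; exact: slope_level_lt.
  - by move=> a aM; exact: slope_level_lt.
  - by move=> m /FGm[].
have r0n : (0 < r)%N := ltnW r1.
have [/andP[rk ki] ki_cell] := cell_startP r i r0n ri.
set k := cell_start _ _ in rk ki ki_cell.
have r0 : 0 < r%:R :> R by rewrite ltr0n.
have rr0 : 0 < (r ^ 2)%:R :> R by rewrite ltr0n expn_gt0 r0n.
have k0 : (0 < k)%N by apply: leq_trans rk; rewrite expn_gt0 r0n.
have k0' : 0 < k%:R :> R by rewrite ltr0n.
have M0 : 0 < (r ^ 4)%:R :> R by rewrite ltr0n expn_gt0 r0n.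
have Mi0 : 0 < (r ^ 4 - i)%:R :> R by rewrite ltr0n subn_gt0.
have dist := odds_cell_dist r k i r1 k0 (introT andP (conj ki iM)) ki_cell.
have i_cell : (odds_cell r i < code_length r)%N.
  apply: (@truncn_ln_lt_code_length _ _ 8) => //; last exact: grid_odds_le.
  by apply: grid_odds_ge1; rewrite iM (leq_trans k0).
have start : `|grid_quantile r F k - grid_quantile r G k| <= (r%:R ^+ 2)^-1.
  have [_ e] := FGm _ i_cell; rewrite -/k in e.
  have kM : (k <= r ^ 4)%N := cell_start_le r _.
  have /andP[u0 _] := grid_quantile_itv r _ _ F1 kM.
  have /andP[w0 _] := grid_quantile_itv r _ _ G1 kM.
  have ru := mulr_ge0 (ltW rr0) u0; have rw := mulr_ge0 (ltW rr0) w0.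
  have := truncn_eq_ltr _ _ ru rw e; have := truncn_eq_ltr _ _ rw ru (esym e).
  rewrite -!mulrBr -natrX ler_norml -(ler_pM2l rr0) -[X in _ && X](ler_pM2l rr0).
  rewrite mulrN divff ?gt_eqF// !mulrBr; clear; lra.
have inM j : (k <= j <= i)%N -> (j <= r ^ 4)%N.
  by move=> /andP[_ ji]; exact: leq_trans ji (ltnW iM).
pose J H j := (r ^ 4)%:R * tail_int H (j%:R / (r ^ 4)%:R) : R.
have hE H j : discrete_irreg B (grid_quantile r H) (J H) j =
    (r ^ 4)%:R * irreg_fun H B (j%:R / (r ^ 4)%:R).
  rewrite /discrete_irreg /J irreg_funE /grid_quantile mulrDr mulrA [in RHS]mulrCA divff ?gt_eqF//.
  by rewrite mulr1 mulrCA.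
have JB H : H 1 = 1 -> forall j, (k <= j < i)%N ->
    grid_quantile r H j.+1 <= J H j.+1 - J H j <= grid_quantile r H j.
  move=> H1 j /andP[_ ji]; have jM := ltn_trans ji iM.
  have /andP[x0 _] := @grid01 R _ _ (ltnW jM); have /andP[_ y1] := @grid01 R _ _ jM.
  have xy : j%:R / (r ^ 4)%:R <= j.+1%:R / (r ^ 4)%:R :> R.
    by rewrite gridS lerDl invr_ge0 ltW.
  have dx : j.+1%:R / (r ^ 4)%:R - j%:R / (r ^ 4)%:R = (r ^ 4)%:R^-1 :> R.
    by rewrite gridS addrAC subrr add0r.
  have := tail_intB H _ _ H1 x0 xy y1.
  by rewrite dx ler_pdivrMl// ler_pdivlMl// mulrBr.
(* Relative error 2/r times the bound on the defects, evaluated at [i], where it is largest in the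
   cell. *)
pose c := 2 / r%:R * ((3 + 2 * B) * ((r ^ 4)%:R / (r ^ 4 - i)%:R)).
have C0 : 0 <= 3 + 2 * B by rewrite addr_ge0// mulr_ge0.
have c0 : 0 <= c by rewrite /c !mulr_ge0// ?divr_ge0// invr_ge0 ltW.
have slopes j : (k <= j < i)%N ->
  `|(discrete_irreg B (grid_quantile r F) (J F) j.+1 -
     discrete_irreg B (grid_quantile r F) (J F) j) -
    (discrete_irreg B (grid_quantile r G) (J G) j.+1 -
     discrete_irreg B (grid_quantile r G) (J G) j)| <= c.
  move=> /andP[_ ji]; have jM := ltn_trans ji iM.
  have zF := slope_defect_ge1 _ _ _ _ F1 B0 cF jM.
  have zG := slope_defect_ge1 _ _ _ _ G1 B0 cG jM.
  have e := levels _ jM.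
  have d1 := truncn_ln_eq_le _ _ _ r1 zF zG e.
  have d2 := truncn_ln_eq_le _ _ _ r1 zG zF (esym e).
  have zc H : H 1 = 1 -> concave_on01 (irreg_fun H B) ->
      2 / r%:R * slope_defect H B (r ^ 4) j <= c.
    move=> H1 cH; rewrite /c ler_wpM2l ?divr_ge0//.
    apply: le_trans (slope_defect_le _ _ _ _ H1 B0 cH jM) _.
    rewrite ler_wpM2l// ler_wpM2l// lef_pV2 ?posrE ?ler_nat ?ltr0n ?subn_gt0//.
    by rewrite leq_sub2l// ltnW.
  rewrite !hE (_ : _ - _ - _ = slope_defect G B (r ^ 4) j - slope_defect F B (r ^ 4) j).
    have := le_trans d1 (zc _ F1 cF); have := le_trans d2 (zc _ G1 cG).
    rewrite ler_norml; move: (slope_defect F _ _ _) (slope_defect G _ _ _) (c).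
    by clear => x y z; lra.
  by rewrite /slope_defect; ring.
(* The distance bound turns [c * (i - k)] into 4 (3 + 2B) k / r^2 and gives [theta = 2/r];
   [kappa = r^-2] works because [k >= r ^ 2]. *)
apply: (@cell_estimate R B c (4 * (3 + 2 * B) / r%:R ^+ 2) (r%:R ^+ 2)^-1 (2 / r%:R)
  (r%:R ^+ 2)^-1 _ k i _ _ (J F) (J G)) => //.
- by move=> j /inM; exact: grid_quantile_itv.
- by move=> j /inM; exact: grid_quantile_itv.
- exact: JB.
- exact: JB.
- have -> : c * (i - k)%:R = 2 / r%:R * ((3 + 2 * B) / (r ^ 4 - i)%:R) *
      ((i - k)%:R * (r ^ 4)%:R) by rewrite /c; ring.
  have p0 : 0 <= 2 / r%:R * ((3 + 2 * B) / (r ^ 4 - i)%:R).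
    by rewrite mulr_ge0// divr_ge0// ltW.
  apply: le_trans (ler_wpM2l p0 dist) _.
  rewrite le_eqVlt; apply/orP; left; apply/eqP.
  by field; rewrite !gt_eqF.
- rewrite -(ler_pM2r M0); apply: le_trans dist _.
  by rewrite ler_wpM2l ?ler_nat ?leq_subr// mulr_ge0// divr_ge0// ltW.
- by rewrite mulrC -natrX ler_pdivlMr// mul1r ler_nat.
- by apply: divr_ge0; rewrite ?exprn_ge0// addr_ge0// mulr_ge0.
(* As [B * theta <= 1/2], E need only be twice the remaining terms, 1 + 4 (3 + 2B) + 2B = 13 + 10B
   in units of r^-2. *)
- have s0 : 0 <= (r%:R ^+ 2)^-1 :> R by rewrite invr_ge0 exprn_ge0.
  have Bt : B * (2 / r%:R) <= 1 / 2.
    rewrite mulrA ler_pdivrMr//; move: Br; clear; lra.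
  have e0 : 0 <= (26 + 20 * B) / r%:R ^+ 2 by rewrite mulr_ge0// addr_ge0// mulr_ge0.
  move: (ler_wpM2r e0 Bt) s0; rewrite -!mulrA.
  by move: (r%:R ^+ 2)^-1 (r%:R^-1) => s t; clear; lra.
Qed.

End Code.

(** * Counting *)

(** One member of the class is chosen for each attained code value, so no decoding is required and
    the representatives inherit [P]. *)
Lemma representatives (A : choiceType) (T : finType) (P : A -> Prop) (f : A -> T) :
  exists s : seq A, [/\ (size s <= #|T|)%N, (forall a, a \in s -> P a) &
    forall a, P a -> exists2 b, b \in s & f a = f b].
Proof.
have [[a0 _]|nP] := pselect (exists a, P a); last first.
  by exists [::]; split => // a Pa; case: nP; exists a.
pose has_rep t := `[< exists2 a, P a & f a = t >].
have : forall t, exists a, has_rep t -> P a /\ f a = t.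
  move=> t; case: (boolP (has_rep t)) => [/asboolP[a Pa fa]|_]; last by exists a0.
  by exists a.
move=> /choice[g gP]; exists [seq g t | t <- enum T & has_rep t]; split.
- by rewrite size_map size_filter cardE count_size.
- by move=> a /mapP[t]; rewrite mem_filter => /andP[/gP[Pg _] _] ->.
- move=> a Pa; have ht : has_rep (f a) by apply/asboolP; exists a.
  exists (g (f a)); last by have [] := gP _ ht.
  by apply: map_f; rewrite mem_filter ht mem_enum.
Qed.

Section Count.
Context {R : realType}.

Lemma card_code_le r : (1 < r)%N ->
  #|{: {ffun 'I_(@code_length R r) -> 'I_(r ^ 4).+1 * 'I_(r ^ 4).+1}}|%:R
    <= expR (10 * ln r%:R * (8 * (r%:R * ln r%:R) + 1)) :> R.
Proof.
move=> r1; rewrite card_ffun card_prod !card_ord.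
have r0 : 0 < r%:R :> R by rewrite ltr0n ltnW.
have lnr : 0 <= ln (r%:R : R) by rewrite ln_ge0// ler1n ltnW.
have le10 : ((r ^ 4).+1 * (r ^ 4).+1)%:R <= expR (10 * ln r%:R) :> R.
  rewrite -[10]/(10%:R) mulr_natl -lnXn// lnK ?posrE ?exprn_gt0//.
  rewrite -natrX ler_nat (_ : 10 = 5 + 5)%N// expnD.
  suff r45 : (r ^ 4 < r ^ 5)%N by rewrite leq_mul.
  by rewrite ltn_exp2l.
rewrite natrX; apply: le_trans (_ : expR (10 * ln r%:R) ^+ code_length r <= _).
  by apply: lerXn2r => //; rewrite nnegrE ?expR_ge0.
rewrite -expRM_natr ler_expR ler_wpM2l ?mulr_ge0//.
by rewrite /code_length -natr1 lerD2r truncn_le ?mulr_ge0// ltW.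
Qed.

End Count.

(** * Choice of the parameters and conclusion *)

Theorem theorem2 (R : realType) (beta : R) (hbeta : 0 <= beta) :
  exists (C : R) (k : nat) (eps0 : R), 0 < C /\ 0 < eps0 /\
    forall eps : R, 0 < eps -> eps < eps0 ->
      exists Cs : seq (R -> R),
        (forall G, G \in Cs -> is_cdf G) /\
        (size Cs)%:R <= 2 `^ (C / Num.sqrt eps * (ln (eps^-1)) ^+ k) /\
        forall F : R -> R, supported01_cdf F ->
          (IrregCoeff F <= beta%:E)%E ->
          exists2 G, G \in Cs & (Levy F G <= eps%:E)%E.
Proof.
pose B := beta + 1; have B0 : 0 <= B by rewrite addr_ge0.
(* [K] dominates both the constant [26 + 20 * B] of the closeness bound and the threshold
   [3 + 4 * B] for [r]. *)
have [K KE] : exists K, K = 27 + 20 * B by exists (27 + 20 * B).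
have K27 : 27 <= K by rewrite KE lerDl mulr_ge0.
have K0 : 0 < K by apply: lt_le_trans K27.
(* Here 90 = 10 (8 + 1) comes from the cardinality bound, [K + 1] from r <= (K + 1)/sqrt eps, and
   [ln 2] from passing to base 2. Below [eps0] this bound on r is at most 1/eps, so
   [ln r <= ln eps^-1]. *)
exists (90 * (K + 1) / ln 2), 2%N, ((K + 1) ^- 2).
have ln2 : 0 < ln (2 : R) by rewrite ln_gt0// ltr1n.
have K1 : 0 < K + 1 by rewrite addr_gt0.
split; first by rewrite divr_gt0// mulr_gt0.
split; first by rewrite invr_gt0 exprn_gt0.
move=> eps eps0 epsK.
set s := Num.sqrt eps.
have s0 : 0 < s by rewrite sqrtr_gt0.
have ss : s ^+ 2 = eps by rewrite sqr_sqrtr// ltW.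
have sK : s * (K + 1) < 1.
  have : (s * (K + 1)) ^+ 2 < 1 by rewrite exprMn ss -ltr_pdivlMr ?exprn_gt0// div1r.
  by rewrite expr_lt1// mulr_ge0// ltW.
(* The least integer above K / sqrt eps: then [s * r > K > 1], and squaring gives K / r^2 < eps. *)
pose r := (Num.truncn (K / s)).+1.
have /andP[rlo rhi] := truncn_itv (ltW (divr_gt0 K0 s0)).
have {}rhi : K / s < r%:R by [].
have {}rlo : r%:R <= K / s + 1 by rewrite /r -natr1 lerD2r.
have s1 : s < 1.
  apply: le_lt_trans sK; rewrite ler_peMr ?ltW//; move: K27; clear; lra.
have rK : K < r%:R by apply: lt_trans rhi; rewrite ltr_pdivlMr// gtr_pMr.
have r1 : (1 < r)%N by rewrite -(ltr_nat R); move: K27 rK; clear; lra.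
have r0 : 0 < r%:R :> R by rewrite ltr0n.
have BrK : 3 + 4 * B <= r%:R by move: B0 rK; rewrite KE; clear; lra.
have rs : r%:R <= (K + 1) / s.
  apply: le_trans rlo _; rewrite mulrDl lerD2l div1r -[X in X <= _]invr1 lef_pV2 ?posrE//.
  exact: ltW.
have r2 : K / r%:R ^+ 2 < eps.
  rewrite -ss ltr_pdivrMr ?exprn_gt0// -exprMn.
  have : K < s * r%:R by rewrite mulrC -ltr_pdivrMr.
  move: (s * r%:R) => x Kx; apply: (lt_trans Kx); rewrite expr2.
  by rewrite ltr_pMr; move: Kx K27; clear; lra.
have lnr : ln r%:R <= ln eps^-1.
  rewrite ler_ln ?posrE ?invr_gt0//; apply: le_trans rs _.
  rewrite -ss ler_pdivrMr// -exprVn expr2 -mulrA mulVf ?gt_eqF// mulr1.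
  by rewrite -div1r ler_pdivlMr// mulrC ltW.
have l0 : 0 <= ln (r%:R : R) by rewrite ln_ge0// ler1n ltnW.
(* This absorbs the [+ 1] of the code length: 1/r >= 1 - ln r gives r ln r >= r - 1. *)
have rl1 : 1 <= r%:R * ln (r%:R : R).
  have := expR_ge1Dx (- ln (r%:R : R)); rewrite expRN lnK ?posrE//.
  move=> /(ler_wpM2l (ltW r0)); rewrite divff ?gt_eqF//; move: K27 rK; clear; lra.
pose P F := supported01_cdf F /\ concave_on01 (irreg_fun F B).
have [Cs [sCs PCs cover]] := representatives (R -> R) _ P (cdf_code B r (@code_length R r)).
exists Cs; split; first by move=> G /PCs[[]].
split.
  apply: le_trans (_ : #|{: {ffun 'I_(@code_length R r) -> 'I_(r ^ 4).+1 * 'I_(r ^ 4).+1}}|%:R <= _).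
    by rewrite ler_nat.
  apply: le_trans (card_code_le r r1) _.
  rewrite /powR gt_eqF ?ltr0n// ler_expR.
  apply: le_trans (_ : 90 * r%:R * ln r%:R ^+ 2 <= _).
    move: rl1 => /(ler_wpM2l l0); clear; lra.
  have -> : 90 * (K + 1) / ln 2 / s * ln eps^-1 ^+ 2 * ln 2 =
      90 * ((K + 1) / s) * ln eps^-1 ^+ 2 by field; rewrite !gt_eqF.
  apply: ler_pM; rewrite ?mulr_ge0 ?exprn_ge0//; first by rewrite ler_wpM2l.
  by apply: lerXn2r; rewrite ?nnegrE// (le_trans l0).
move=> F cF IF.
have F1 := supported01_1 _ cF.
have PF : P F.
  by split=> //; apply: IrregCoeff_concave IF _ => //; rewrite ltrDl.
have [G GCs FG] := cover F PF; exists G => //.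
have [cG concG] := PCs _ GCs; have G1 := supported01_1 _ cG.
(* Nothing is known at the first [r ^ 2] grid points; they carry mass about r^-2, which the vertical
   tolerance of the Lévy distance absorbs. *)
apply: (grid_Levy_le F G (r ^ 2) (r ^ 4)) => //.
- apply: ltW; apply: le_lt_trans r2.
  rewrite ler_pdivrMr ?ltr0n ?expn_gt0// natrX -natr1 natrX.
  have -> : K / r%:R ^+ 2 * r%:R ^+ 4 = K * r%:R ^+ 2 by field; rewrite gt_eqF.
  have : 1 <= r%:R ^+ 2 :> R by rewrite exprn_ege1// ler1n.
  move: (r%:R ^+ 2) => x x1; have := ler_wpM2r (le_trans ler01 x1) K27.
  move: x1; clear; lra.
- move=> i ri; apply: le_lt_trans r2.
  apply: le_trans (code_quantile_close _ _ _ _ _ F1 G1 B0 (proj2 PF) concG r1 BrK FG ri) _.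
  rewrite ler_wpM2r ?invr_ge0 ?exprn_ge0// KE; clear; lra.
Qed.
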